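(* Let $m\ge1$ and let $a_1,\ldots,a_m$ be a sequence of positive integers, with $q_i$ and $H_N$ as in the context. If $N=q_{m-1}-1$ or $N=q_m-1$, then $H_N(a_1,\ldots,a_m)$ is a Christoffel word and has no border. Now let $0\le N\le q_m-1$ with $N\ne q_{m-1}-1$ and $N\neq q_m-1$, and denote by $B_N$ the longest border of $H_N(a_1,\ldots,a_m)$. (a) Suppose that $a_m\ge 2$. If $0\le N<q_{m-1}-1$, then $B_N=H_N(a_1,\ldots,a_{m-1},a_m-1)$. If $q_{m-1}\le N<q_m-1$, then $B_N=H_N(a_1,\ldots,a_{m-1})^t$, where $t=\min\left\{\left\lfloor\frac{N}{q_{m-1}}\right\rfloor,\,1+\left\lfloor\frac{q_m-2-N}{q_{m-1}}\right\rfloor\right\}$. (b) Suppose that $a_m=1$. If $0\le N<q_{m-1}-1$, then $B_N=H_N(a_1,\ldots,a_{m-2})^t$, where $t=1+\min\left\{\left\lfloor\frac{N}{q_{m-2}}\right\rfloor,\,\left\lfloor\frac{q_{m-1}-2-N}{q_{m-2}}\right\rfloor\right\}$. If $q_{m-1}\le N<q_m-1$, then $B_N=H_N(a_1,\ldots,a_{m-1})$.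
   Context: Words are over $A=\{a,b\}$. A border of a word is a nonempty proper prefix which is also a suffix of this word. The conjugator $C:A^*\to A^*$ maps $xu$ ($x\in A$, $u\in A^*$) to $ux$, and fixes the empty word; $C$ is a bijection, so $C^N$ makes sense for $N\in\mathbb Z$. For positive integers $a_1,\ldots,a_m$ ($m\ge0$): $q_{-1}=0$, $q_0=1$, $q_i=a_iq_{i-1}+q_{i-2}$; $b_1=a_1-1$ and $b_i=a_i$ for $i\ge2$; $M_{-1}=b$, $M_0=a$, $M_i=M_{i-1}^{\,b_i}M_{i-2}$ for $1\le i\le m$. The word $M_m$ has length $q_m$. Define $H_N(a_1,\ldots,a_m)=C^N(M_m)$, for $N\in\mathbb Z$, where $M_m$ is the word corresponding to the sequence $a_1,\ldots,a_m$ (for the empty sequence, $M_0=a$); it depends only on $N$ modulo $q_m$. Write $(u,v)$ for the endomorphism of $A^*$ sending $a\mapsto u$, $b\mapsto v$, and let $G=(a,ab)$, $\widetilde G=(a,ba)$, $D=(ba,b)$, $\widetilde D=(ab,b)$. A lower (resp. upper) Christoffel word is the image of $a$ or $b$ under an element of the monoid of endomorphisms generated by $G$ and $\widetilde D$ (resp. by $\widetilde G$ and $D$). A Christoffel word is a lower or an upper Christoffel word. *)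

(* Defs.v *)
From mathcomp Require Import all_boot ssrint.
Set Implicit Arguments.
Unset Strict Implicit.
Unset Printing Implicit Defensive.

(** The alphabet {a, b} is [bool]; [la] and [lb] are the letters a and b. *)
Definition word := seq bool.
Definition la : bool := false.
Definition lb : bool := true.

Definition wpow (u : word) (n : nat) : word := flatten (nseq n u).

Definition border (u w : word) : bool :=
  [&& u != [::], u != w, prefix u w & suffix u w].

Definition unbordered (w : word) : Prop := forall u, ~~ border u w.

Definition longest_border (u w : word) : Prop :=
  border u w /\ (forall v, border v w -> size v <= size u).

(** The conjugator C; [conjugator_pow N] is C^N, where C^-1 is [rotr 1]
    (see [conjugatorK] and [conjugatorVK]). *)
Definition conjugator (w : word) : word :=
  if w is x :: u then rcons u x else [::].

Lemma conjugatorE w : conjugator w = rot 1 w.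
Proof. by case: w => [|x u] //=; rewrite rot1_cons. Qed.

Lemma conjugatorK : cancel conjugator (rotr 1).
Proof. by move=> w; rewrite conjugatorE rotK. Qed.

Lemma conjugatorVK : cancel (rotr 1) conjugator.
Proof. by move=> w; rewrite conjugatorE rotrK. Qed.

Definition conjugator_pow (N : int) (w : word) : word :=
  match N with
  | Posz n => iter n conjugator w
  | Negz n => iter n.+1 (rotr 1) w
  end.

(** [term s i] is a_i for s = (a_1, ..., a_m) and 1 <= i <= m. *)
Definition term (s : seq nat) (i : nat) : nat := nth 0 s i.-1.

(** In [q] and [M] the value at i' = 0 of the inner match is the initial
    value of index -1. *)
Fixpoint q (s : seq nat) (i : nat) : nat :=
  match i with
  | 0 => 1
  | i'.+1 => term s i * q s i' + (if i' is i''.+1 then q s i'' else 0)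
  end.

Definition bterm (s : seq nat) (i : nat) : nat :=
  if i == 1 then term s 1 - 1 else term s i.

Fixpoint M (s : seq nat) (i : nat) : word :=
  match i with
  | 0 => [:: la]
  | i'.+1 => wpow (M s i') (bterm s i)
             ++ (if i' is i''.+1 then M s i'' else [:: lb])
  end.

Definition H (N : int) (s : seq nat) : word := conjugator_pow N (M s (size s)).

(** [endo u v] is the endomorphism (u, v): a |-> u, b |-> v. *)
Definition endo (u v w : word) : word :=
  flatten [seq if x == la then u else v | x <- w].

Definition endoG : word -> word := endo [:: la] [:: la; lb].
Definition endoGt : word -> word := endo [:: la] [:: lb; la].
Definition endoD : word -> word := endo [:: lb; la] [:: lb].
Definition endoDt : word -> word := endo [:: la; lb] [:: lb].

Inductive generated2 (f g : word -> word) : (word -> word) -> Prop :=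
| generated2_id : generated2 f g id
| generated2_l : generated2 f g f
| generated2_r : generated2 f g g
| generated2_comp h k :
    generated2 f g h -> generated2 f g k -> generated2 f g (h \o k).

Definition lower_christoffel (w : word) : Prop :=
  exists2 h, generated2 endoG endoDt h & w = h [:: la] \/ w = h [:: lb].

Definition upper_christoffel (w : word) : Prop :=
  exists2 h, generated2 endoGt endoD h & w = h [:: la] \/ w = h [:: lb].

Definition christoffel (w : word) : Prop :=
  lower_christoffel w \/ upper_christoffel w.

(* Main.v *)
Require Import Defs.
From mathcomp Require Import all_boot all_order all_algebra ssrint zify.

(** The words [u = M_i] and [v = M_{i-1}] almost commute: [u ++ v] and
    [v ++ u] share a prefix [P] and differ only by the order of their last two
    letters.  Such standard pairs are closed under the step from [(u, v)] to
    [(u^e v, u)], so the whole statement reduces to the rotations of a single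
    word [w = u^e v] attached to a standard pair, with [|u| = q_{m-1}] and
    [e = a_m] (or [a_1 - 1] when [m = 1]).

    When [e > 0], rotating [w] by [|u| - 1] or by [|w| - 1] gives the two words
    [z u^(e-1) P z'] with [z <> z'] (when [e = 0], [w] is a letter).  These occur
    in the Christoffel tree, the tree of pairs generated from two letters by
    [(c, d) -> (c, cd)] and [(c, d) -> (cd, d)]; its components are Christoffel
    words because the two moves are composition on the right with the two
    generators of the monoid of endomorphisms.  They are unbordered because, in
    lattice path terms, the proper nonempty prefixes of a component end strictly
    on one side of its chord, so that the Parikh vectors of its proper nonempty
    suffixes point strictly to the other side
    ([below_chord_unbordered], [tree_below], [standard_christoffel]).

    For the other rotations, near commutation says that in the periodic word
    [w w w ...] the period [|u|] continues past each block [u^e] over the whole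
    of [P], and is broken right after it.  Reading a rotation of [w] inside this
    run exhibits the announced border.  It is longest by the following
    principle ([longest_border_unbordered_infix]): a border of length [k] is a
    period [|w| - k], and a word with an unbordered factor of length [l] has no
    period below [l].  The factor used is an unbordered conjugate of [u] when
    [N < |u| - 1] ([longest_border_short_rot]), and the word [z u^(e-t-1) P z'],
    of length [|w| - t |u|], when the border is a power with exponent [t]
    ([longest_border_long_rot]); the two terms of the minimum defining [t]
    correspond to the two choices of [z].

    When [a_m = 1] and [m >= 2], [M_m = M_{m-1} M_{m-2}] is a rotation of
    [M_{m-2} M_{m-1}], which is the standard word of the shorter sequence
    [a_1, ..., a_{m-2}, a_{m-1} + 1]; the case of a last term at least 2,
    applied to it with [N] shifted by [q_{m-2}], gives the remaining clauses. *)

#[local] Arguments wpow : simpl never.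

(** * Powers and prefixes of words *)

Lemma wpowS u n : wpow u n.+1 = u ++ wpow u n.
Proof. by []. Qed.

Lemma wpowD u m n : wpow u (m + n) = wpow u m ++ wpow u n.
Proof. by rewrite /wpow nseqD flatten_cat. Qed.

Lemma wpowSr u n : wpow u n.+1 = wpow u n ++ u.
Proof. by rewrite -addn1 wpowD /wpow /= cats0. Qed.

Lemma size_wpow u n : size (wpow u n) = n * size u.
Proof. by elim: n => //= n IH; rewrite wpowS size_cat IH mulSn. Qed.

Lemma wpow_semiconj d u p k : p ++ d = u ++ p -> p ++ wpow d k = wpow u k ++ p.
Proof.
move=> pd; elim: k => [|k IH]; first by rewrite /wpow /= cats0.
by rewrite wpowS catA pd -catA IH wpowS catA.
Qed.

Lemma prefix_cat_cases (p c d : word) :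
  prefix p (c ++ d) -> prefix p c \/ exists2 p', p = c ++ p' & prefix p' d.
Proof.
elim: c p => [|x c IH] [|y p]; [by left| by right; exists (y :: p)| by left|].
rewrite cat_cons !prefix_cons => /andP[/eqP-> /IH[pc|[p' -> p'd]]].
  by left; rewrite eqxx.
by right; exists p'.
Qed.

(** * The Christoffel tree *)

Section Tree.
Variable z : bool.

(** For [z = la] the components are the lower Christoffel words, for [z = lb] the
    upper ones: exchanging the two letters exchanges [endoG] with [endoD] and
    [endoDt] with [endoGt]. *)
Inductive tree_pair : word -> word -> Prop :=
| tree_root : tree_pair [:: z] [:: ~~ z]
| tree_left c d : tree_pair c d -> tree_pair c (c ++ d)
| tree_right c d : tree_pair c d -> tree_pair (c ++ d) d.

Lemma tree_left_pow c d k : tree_pair c d -> tree_pair c (wpow c k ++ d).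
Proof. by move=> cd; elim: k => //= k IH; rewrite wpowS -catA; constructor. Qed.

Lemma tree_right_pow c d k : tree_pair c d -> tree_pair (c ++ wpow d k) d.
Proof.
move=> cd; elim: k => [|k IH]; first by rewrite cats0.
by rewrite wpowSr catA; constructor.
Qed.

(** The determinant of the Parikh vectors of [p] and [w]; its sign tells on
    which side of the chord of [w] the lattice path of [p] ends. *)
Definition det (p w : word) : int :=
  (count_mem z p * count_mem (~~ z) w)%:Z - (count_mem (~~ z) p * count_mem z w)%:Z.

Lemma det_catl p p' w : (det (p ++ p') w = det p w + det p' w)%R.
Proof. rewrite /det !count_cat !mulnDl; lia. Qed.

Lemma det_catr p w w' : (det p (w ++ w') = det p w + det p w')%R.
Proof. rewrite /det !count_cat !mulnDr; lia. Qed.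

Lemma det_self w : det w w = 0%R.
Proof. rewrite /det mulnC; lia. Qed.

Lemma det_nil w : det [::] w = 0%R.
Proof. by []. Qed.

Definition below_chord (w : word) :=
  forall p, prefix p w -> p != [::] -> p != w -> (1 <= det p w)%R.

(** If [w = r ++ p] with [p] also a prefix, then [det r w] and [det p w] are both
    positive, but their sum is [det w w = 0]. *)
Lemma below_chord_unbordered w : below_chord w -> unbordered w.
Proof.
move=> bw p; apply/negP => /and4P[p0 pw pre /suffixP[r wE]].
have dp := bw p pre p0 pw.
have r0 : r != [::].
  by apply/eqP => r0; move: pw; rewrite wE r0 eqxx.
have rw : r != w.
  apply/eqP => /(congr1 size) /eqP; rewrite wE size_cat -{1}[size r]addn0.
  by rewrite eqn_add2l eq_sym size_eq0 (negPf p0).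
have dr := bw r ltac:(by rewrite wE prefix_prefix) r0 rw.
have := det_self w; rewrite {1}wE det_catl; lia.
Qed.

(** The last two bounds make the chord condition inductive: in [c ++ d] the
    prefixes are compared with the chords of [c] and [d] separately, and a prefix
    of [d] may fall behind the direction of [c], by at most the determinant
    [det c d = 1] gained by reading [c] first. *)
Definition below_pair (c d : word) :=
  [/\ det c d = 1%R, below_chord c, below_chord d,
      forall p, prefix p c -> p != [::] -> (1 <= det p d)%R
    & forall p, prefix p d -> (-1 <= det p c)%R].

Lemma below_chord_ge0 {w p} : below_chord w -> prefix p w -> (0 <= det p w)%R.
Proof.
move=> bw pw; have [->|p0] := eqVneq p [::]; first by rewrite det_nil.
have [->|pnw] := eqVneq p w; first by rewrite det_self.
have := bw p pw p0 pnw; lia.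
Qed.

Lemma below_chord_cat {c d} : below_pair c d -> below_chord (c ++ d).
Proof.
case=> dcd bc bd pcd pdc p /prefix_cat_cases[pc|[p' pE p'd]] p0 pn.
  rewrite det_catr; have := pcd p pc p0; have := below_chord_ge0 bc pc; lia.
rewrite pE in pn *; rewrite det_catl !det_catr det_self dcd.
have [p'0|p'0] := eqVneq p' [::]; first by rewrite p'0 !det_nil.
have p'n : p' != d by apply: contra pn => /eqP->.
have := bd p' p'd p'0 p'n; have := pdc p' p'd; lia.
Qed.

Lemma tree_below c d : tree_pair c d -> below_pair c d.
Proof.
elim=> {c d} [|c d _ B|c d _ B].
- have one x : below_chord [:: x].
    case=> [|y [|y' p]] //; rewrite !prefix_cons ?andbF //.
    by move=> /andP[/eqP->] _ _; rewrite eqxx.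
  split=> //.
  + by rewrite /det /= !eqxx; case: (z).
  + case=> [|y [|y' p]] //; rewrite !prefix_cons ?andbF // => /andP[/eqP-> _] _.
    by rewrite /det /= !eqxx; case: (z).
  + case=> [|y [|y' p]] //; rewrite !prefix_cons ?andbF // => /andP[/eqP-> _].
    by rewrite /det /= !eqxx; case: (z).
- have bcd := below_chord_cat B; case: B => dcd bc bd pcd pdc.
  split=> //.
  + by rewrite det_catr det_self dcd.
  + move=> p pc p0; rewrite det_catr.
    have := pcd p pc p0; have := below_chord_ge0 bc pc; lia.
  + move=> p /prefix_cat_cases[pc|[p' -> p'd]].
      have := below_chord_ge0 bc pc; lia.
    rewrite det_catl det_self; have := pdc p' p'd; lia.
- have bcd := below_chord_cat B; case: B => dcd bc bd pcd pdc.
  split=> //.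
  + by rewrite det_catl det_self dcd.
  + move=> p /prefix_cat_cases[pc|[p' -> p'd]] p0; first exact: pcd.
    rewrite det_catl dcd; have := below_chord_ge0 bd p'd; lia.
  + move=> p pd; rewrite det_catr.
    have := below_chord_ge0 bd pd; have := pdc p pd; lia.
Qed.

Lemma tree_unbordered c d : tree_pair c d -> unbordered c /\ unbordered d.
Proof. by move=> /tree_below[_ bc bd _ _]; split; apply: below_chord_unbordered. Qed.

End Tree.

Lemma endo_cat f g w w' : endo f g (w ++ w') = endo f g w ++ endo f g w'.
Proof. by rewrite /endo map_cat flatten_cat. Qed.

Lemma generated2_cat f g h :
  {morph f : x y / x ++ y} -> {morph g : x y / x ++ y} ->
  generated2 f g h -> {morph h : x y / x ++ y}.
Proof. by move=> fM gM; elim=> {h} //= h k _ hM _ kM x y; rewrite /= kM hM. Qed.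

(** If [(c, d)] is the image of the two letters under [h], the two children are
    their images under [h \o g] with [g] one of the two generators; [h] is a
    morphism for concatenation, so it can be applied letter by letter. *)
Lemma tree_christoffel z c d : tree_pair z c d -> christoffel c /\ christoffel d.
Proof.
pose gen h := if z then generated2 endoGt endoD h else generated2 endoG endoDt h.
have genM h : gen h -> {morph h : x y / x ++ y}.
  rewrite /gen; case: (z); apply: generated2_cat => x y; exact: endo_cat.
move=> cd.
suff [h [hg <- <-]] : exists h, [/\ gen h, h [:: z] = c & h [:: ~~ z] = d].
  by move: hg; rewrite /gen; case: (z) => hg; split;
    [right|right|left|left]; exists h => //=; [right|left|left|right].
elim: cd => {c d} [|c d _ [h [hg <- <-]]|c d _ [h [hg <- <-]]].
- by exists id; split=> //; rewrite /gen; case: (z); constructor.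
- have hM := genM h hg; exists (h \o (if z then endoD else endoG)); split.
  + by move: hg; rewrite /gen; case: (z) => hg; apply: generated2_comp => //; constructor.
  + by case: (z).
  + by rewrite -hM; case: (z).
- have hM := genM h hg; exists (h \o (if z then endoGt else endoDt)); split.
  + by move: hg; rewrite /gen; case: (z) => hg; apply: generated2_comp => //; constructor.
  + by rewrite -hM; case: (z).
  + by case: (z).
Qed.

(** * Standard pairs *)

(** The word [P] is the central word of the pair.  The field [std_tree] ties the
    pair to both Christoffel trees through [z P z'], the concatenation of a tree
    pair [(c, d)].  Its last clause, whose form depends on the order in which
    [u ++ v] ends, is what allows one to insert powers of [u] in front of [P]: it
    says that [z u^k P z'] is [c^(k+1) d] in one case and [c d^(k+1)] in the
    other. *)
Record standard_pair (u v P : word) (x : bool) : Prop := {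
  std_uv : u ++ v = P ++ [:: x; ~~ x];
  std_vu : v ++ u = P ++ [:: ~~ x; x];
  std_size : size v <= size u;
  std_tree : forall z, exists c d, [/\ tree_pair z c d,
    c ++ d = z :: P ++ [:: ~~ z] &
    if x == z then c ++ [:: z] = z :: u
    else (P ++ [:: ~~ z]) ++ d = u ++ P ++ [:: ~~ z]]
}.

Lemma standard_pair_root x : standard_pair [:: x] [:: ~~ x] [::] x.
Proof.
split=> // z; exists [:: z], [:: ~~ z]; split=> //; first by constructor.
by case: x z => [] [].
Qed.

(** Descending [k + 1] times in the tree along one branch lengthens [P] by
    powers of [u].  The final equations locate the letters after [P] and are
    those needed to iterate the construction. *)
Lemma standard_pair_tree {u v P x} : standard_pair u v P x -> forall z k,
  exists c d, [/\ tree_pair z c d, c ++ d = z :: wpow u k.+1 ++ P ++ [:: ~~ z] &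
    if x == z then d = z :: wpow u k ++ P ++ [:: ~~ z] /\
       (P ++ [:: ~~ z] ++ [:: z] = v ++ u)
    else c = z :: wpow u k ++ P ++ [:: ~~ z] /\ P ++ [:: ~~ z] ++ [:: z] = u ++ v].
Proof.
case=> uv vu _ tr z k; have [c [d [cd cdE]]] := tr z.
case: eqVneq => [xz|xz] inv.
- have powE j : wpow c j.+1 ++ d = z :: wpow u j ++ P ++ [:: ~~ z].
    rewrite wpowSr -catA cdE -[z :: P ++ _]cat1s catA.
    by rewrite -(wpow_semiconj u c [:: z] j (esym inv)).
  exists c, (wpow c k.+1 ++ d); split; first exact: tree_left_pow.
    by rewrite catA -wpowS powE.
  by split; [exact: powE | rewrite vu xz].
- have zx : x = ~~ z by case: (x) (z) xz => [] [].
  have powE j : c ++ wpow d j.+1 = z :: wpow u j ++ P ++ [:: ~~ z].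
    by rewrite wpowS catA cdE cat_cons (wpow_semiconj _ _ _ _ inv).
  exists (c ++ wpow d k.+1), d; split; first exact: tree_right_pow.
    by rewrite -catA -wpowSr powE.
  by split; [exact: powE | rewrite uv zx negbK].
Qed.

(** The roles of the two letters are exchanged, since
    [(u^e v) u = u^e (v u)] while [u (u^e v) = u^e (u v)].  On the tree side the
    pair reached from [(c, d)] is the pair of [standard_pair_tree] with exponent
    [e], which requires [e] to be positive. *)
Lemma standard_pair_step {u v P x} e : 0 < e -> standard_pair u v P x ->
  standard_pair (wpow u e ++ v) u (wpow u e ++ P) (~~ x).
Proof.
case: e => // e _ std; have [uv vu le _] := std; split.
- by rewrite -!catA vu negbK.
- by rewrite catA -wpowS wpowSr -!catA uv negbK.
- by rewrite size_cat size_wpow mulSn -addnA leq_addr.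
- move=> z; have [c [d [cd cdE +]]] := standard_pair_tree std z e.
  have -> : (~~ x == z) = (x != z) by case: (x) (z) => [] [].
  move=> inv; exists c, d; rewrite if_neg.
  case: (eqVneq x z) inv => _ [E uvE]; split=> //; rewrite ?cdE wpowS -?catA //;
    rewrite E.
  + congr (u ++ (_ ++ _)); rewrite -[z :: _]cat1s [RHS]catA -uvE.
    by rewrite -!catA.
  + by rewrite cat_cons -!catA uvE [u ++ _ ++ v]catA -wpowS wpowSr -catA.
Qed.

Lemma standard_christoffel {u v P x} z k : standard_pair u v P x ->
  christoffel (z :: wpow u k ++ P ++ [:: ~~ z]) /\
  unbordered (z :: wpow u k ++ P ++ [:: ~~ z]).
Proof.
move=> std; have [c [d [cd _]]] := standard_pair_tree std z k.
have [chc chd] := tree_christoffel _ _ _ cd.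
have [ubc ubd] := tree_unbordered _ _ _ cd.
by case: eqVneq => _ [<- _].
Qed.

Lemma prefix_cat2l (s p r : word) : prefix (s ++ p) (s ++ r) = prefix p r.
Proof. by rewrite prefix_catr // eqxx. Qed.

Lemma word_neq_nil (w : word) : 0 < size w -> w != [::].
Proof. by case: w. Qed.

(** Comparing last letters in the two near-commutation equations.  The word
    [v0] is a prefix of [u] because [P] starts both [u ++ v] and [v ++ u]. *)
Lemma standard_pair_ends {u v P x} : standard_pair u v P x ->
  exists u0 v0, [/\ u = u0 ++ [:: x], v = v0 ++ [:: ~~ x],
    v ++ u0 = P ++ [:: ~~ x], u ++ v0 = P ++ [:: x] & prefix v0 u].
Proof.
case=> uv vu le _.
case/lastP: u => [|u0 x'] in uv vu le *.
  by move: (congr1 size uv); rewrite size_cat /=; case: (v) le; rewrite //= size_cat addn2.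
case/lastP: v => [|v0 y] in uv vu le *.
  by move: vu; rewrite cats0 /= in uv *; rewrite uv => /eqP;
    rewrite eqseq_cat // eqxx /= eqseq_cons; case: (x).
move: (uv) (vu); rewrite -[[:: x; _]]/([:: x] ++ [:: ~~ x]) -[[:: ~~ x; x]]/([:: ~~ x] ++ [:: x]).
rewrite !catA !cats1 -!rcons_cat => /rcons_inj[uv0 yE] /rcons_inj[vu0 xE].
rewrite yE xE in uv vu le uv0 vu0 *.
exists u0, v0; rewrite !cats1; split=> //.
have szP : size v0 <= size P.
  move: (congr1 size uv0); rewrite size_cat !size_rcons; lia.
rewrite prefixE; apply/eqP.
have := congr1 (take (size v0)) uv0; rewrite -cats1 takel_cat; last first.
  by move: le; rewrite !size_rcons ltnS => /leqW; rewrite size_cat addn1.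
move=> ->; rewrite -cats1 takel_cat //.
have := congr1 (take (size v0)) vu0.
by rewrite -!cats1 -catA take_size_cat // takel_cat.
Qed.

(** The period [|u|] of a power of [u] extends over [P] and one more letter. *)
Lemma standard_pair_run {u v P x} : standard_pair u v P x ->
  prefix (P ++ [:: x]) (u ++ u).
Proof.
move=> std; have [u0 [v0 [_ _ _ <- v0u]]] := standard_pair_ends std; by rewrite prefix_cat2l.
Qed.

Lemma take_drop_prefix {X Y : word} {i l} :
  prefix X Y -> i + l <= size X -> take l (drop i X) = take l (drop i Y).
Proof.
by move=> /prefixP[Z ->] le; rewrite !take_drop takel_cat // addnC.
Qed.

(** A factor of a word of period [|u|] whose length is a multiple of [|u|] is a
    power of the conjugate of [u] determined by its position modulo [|u|]. *)
Lemma take_drop_wpow (u : word) i t K : i + t * size u <= K * size u ->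
  take (t * size u) (drop i (wpow u K)) = wpow (rot (i %% size u) u) t.
Proof.
case: (posnP (size u)) => [/size0nil -> _|u_gt0 le].
  by elim: (t) => [|k IH]; rewrite muln0 take0 // wpowS -IH muln0 take0.
set r := i %% size u; set d := rot r u.
have r_lt : r < size u by rewrite ltn_mod.
have iE := divn_eq i (size u); set j := i %/ size u in iE.
have jK : j + t <= K.
  rewrite -(leq_pmul2r u_gt0) mulnDl; apply: leq_trans le.
  by rewrite leq_add2r leq_divM.
have -> : K = j + t + (K - (j + t)) by lia.
set s := K - (j + t).
have comm : take r u ++ wpow d t = wpow u t ++ take r u.
  by apply: wpow_semiconj; rewrite /d /rot catA cat_take_drop.
have : prefix (take r u) (wpow u s).
  case sE: s => [|s'].
    suff -> : r = 0 by rewrite take0.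
    by move: le; rewrite iE; nia.
  rewrite wpowS; apply: (prefix_trans (prefix_take _ _)); exact: prefix_prefix.
move=> /prefixP[Z sE].
rewrite -addnA wpowD drop_cat size_wpow iE ltnNge leq_addr /= addKn.
rewrite wpowD sE catA -comm -catA drop_size_cat; last by rewrite size_take r_lt.
by rewrite take_size_cat // size_wpow size_rot.
Qed.

(** * Borders and unbordered factors *)

(** A border [v] makes [w] invariant under the shift by [|w| - |v|]; if [F] were
    longer than this shift, the shift would give [F] a border. *)
Lemma unbordered_infix_bound {F w v : word} :
  unbordered F -> infix F w -> border v w -> size v + size F <= size w.
Proof.
move=> ubF /infixP[A [C wE]] /and4P[_ vw /prefixP[s ws] /suffixP[r wr]].
rewrite leqNgt; apply/negP => lt.
have rw : size w = size r + size v by rewrite wr size_cat.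
have r_gt0 : 0 < size r.
  rewrite lt0n size_eq0; apply: contra vw => /eqP r0.
  by rewrite wr r0.
have Fr : size r < size F by lia.
have FE : drop (size r) F = take (size F - size r) F.
  apply: (@eq_from_nth _ la) => [|i].
    by rewrite size_drop size_takel // leq_subr.
  rewrite size_drop => i_lt; rewrite nth_drop nth_take //.
  have at_w j : j < size F -> nth la F j = nth la w (size A + j).
    move=> jF; rewrite wE nth_cat ltnNge leq_addr /= addKn nth_cat jF //.
  rewrite !at_w; [|lia|lia].
  have szw : size w = size A + (size F + size C) by rewrite wE !size_cat.
  rewrite {1}wr {1}ws !nth_cat.
  have -> : (size A + (size r + i) < size r) = false by lia.
  have -> : size A + i < size v by lia.
  by congr (nth _ _ _); rewrite addnCA addKn.
move: (ubF (drop (size r) F)); apply/negP/negPn/and4P; split.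
- by rewrite -size_eq0 size_drop subn_eq0 -ltnNge.
- apply/eqP => /(congr1 size) /eqP; rewrite size_drop.
  by rewrite ltn_eqF // ltn_subrL r_gt0 (leq_trans _ Fr).
- by rewrite FE prefix_take.
- exact: suffix_drop.
Qed.

Lemma longest_border_unbordered_infix {B w F : word} :
  B != [::] -> size B < size w -> prefix B w -> suffix B w ->
  unbordered F -> infix F w -> size w <= size B + size F -> longest_border B w.
Proof.
move=> B0 Bw pre suf ubF Fw szF; split.
  apply/and4P; split=> //; apply/eqP => BE; by rewrite BE ltnn in Bw.
move=> v vw; rewrite -(leq_add2r (size F)).
exact: leq_trans (unbordered_infix_bound ubF Fw vw) szF.
Qed.

(** * Longest borders of the rotations of [u^e v] *)

Lemma rot_cat_le N (u X : word) : N <= size u ->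
  rot N (u ++ X) = drop N u ++ X ++ take N u.
Proof.
move=> le; rewrite /rot takel_cat // drop_cat.
case: ltnP => ge; first by rewrite -catA.
have -> : N = size u by lia.
by rewrite subnn drop0 drop_size.
Qed.

(** The rotation has period [|u|]: it starts inside the first [u] and stops
    before the last two letters of [u^e v u], where the period breaks.  It
    contains the rotation of [u] that starts with its last letter. *)
Lemma longest_border_short_rot {u v P x} e N : standard_pair u v P x ->
  unbordered (rotr 1 u) -> 1 < e -> N.+1 < size u ->
  longest_border (rot N (wpow u e.-1 ++ v)) (rot N (wpow u e ++ v)).
Proof.
case: e => [|[|e]] //= std ubu _ N_lt.
have [u0 [v0 [uE _ vu0 _ _]]] := standard_pair_ends std.
have szu : size u = (size u0).+1 by rewrite uE cats1 size_rcons.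
have N_le0 : N <= size u0 by lia.
have N_le : N <= size u by lia.
rewrite !wpowS -!catA !rot_cat_le //.
set B := drop N u ++ _.
have wE : drop N u ++ (u ++ wpow u e ++ v) ++ take N u = rot N u ++ B.
  by rewrite /B /rot -!catA [take N u ++ drop N u ++ _]catA cat_take_drop.
apply: (longest_border_unbordered_infix _ _ _ _ ubu).
- by apply: word_neq_nil; rewrite /B size_cat size_drop; lia.
- by rewrite wE size_cat size_rot; lia.
- (* [v ++ take N u] is cut before the two letters where [u ++ v] and [v ++ u]
     differ. *)
  rewrite /B prefix_cat2l -catA [u ++ wpow u e ++ _]catA -wpowS wpowSr -!catA.
  rewrite !prefix_cat2l.
  have vu1 : v ++ take N u = take (size v + N) P.
    have szP : size v + size u0 = (size P).+1.
      by rewrite -size_cat vu0 size_cat addn1.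
    have -> : take N u = take N u0 by rewrite uE takel_cat.
    have <- : take (size v + N) (P ++ [:: ~~ x]) = take (size v + N) P.
      by rewrite takel_cat //; lia.
    by rewrite -vu0 take_cat ltnNge leq_addr /= addKn.
  rewrite [u ++ _]catA (std_uv _ _ _ _ std) vu1 -catA.
  apply: (prefix_trans (prefix_take _ _)); exact: prefix_prefix.
- by rewrite wE suffix_suffix.
- have -> : rotr 1 u = x :: u0 by rewrite uE cats1 rotr1_rcons.
  apply/infixP; exists (drop N u0), ([:: x] ++ (wpow u e ++ v) ++ take N u).
  rewrite {1}uE drop_cat.
  case: ltnP => ge; first by rewrite {1}uE -!catA.
  have -> : N = size u0 by lia.
  by rewrite subnn drop0 drop_size {1}uE -!catA.
- by rewrite wE size_cat size_rot size_rotr addnC.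
Qed.

(** Here the rotation consists of the end of one run of period [|u|], followed
    by the beginning of the next run; the exponent [t] is limited by the length
    of the shorter of the two overlaps.  The condition on [e] and [v] forces
    [t < e], so that the unbordered factor [z u^(e-t-1) P z'] exists. *)
Lemma longest_border_long_rot {u v P x} e N : standard_pair u v P x ->
  1 < e \/ size v = 1 -> size u <= N -> N.+1 < size (wpow u e ++ v) ->
  longest_border
    (wpow (rot (N %% size u) u)
       (minn (N %/ size u) (1 + (size (wpow u e ++ v) - 2 - N) %/ size u)))
    (rot N (wpow u e ++ v)).
Proof.
move=> std e_cond N_ge.
have [u0 [v0 [uE vE vu0 uv0 _]]] := standard_pair_ends std.
have [uv vu v_le _] := std.
set w := wpow u e ++ v; set Q := size u; set t := minn _ _ => N_lt.
have Q_gt0 : 0 < Q by rewrite /Q uE size_cat addn1.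
have szw : size w = e * Q + size v by rewrite size_cat size_wpow.
have szP : size P + 2 = Q + size v.
  by rewrite /Q -size_cat uv size_cat.
have d1 := leq_divM N Q; have d2 := ltn_ceil N Q_gt0.
have d3 := leq_divM (size w - 2 - N) Q; have d4 := ltn_ceil (size w - 2 - N) Q_gt0.
have t_gt0 : 0 < t by rewrite /t leq_min divn_gt0 // N_ge.
have tN : t * Q <= N.
  by apply: leq_trans d1; rewrite leq_mul2r geq_minl orbT.
have tn : t * Q <= size w - 2 - N + Q.
  have : t * Q <= (1 + (size w - 2 - N) %/ Q) * Q.
    by rewrite leq_mul2r geq_minr orbT.
  by rewrite mulnDl mul1n; lia.
(* Which of the two terms realizes the minimum decides between the two
   unbordered factors below. *)
have t_or : N < t.+1 * Q \/ size w - 2 - N < t * Q.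
  rewrite /t; case: (leqP (N %/ Q)) => _; first by left; exact: d2.
  by right; rewrite add1n; exact: d4.
have t_lt : t < e.
  have : 2 * (t * Q) <= e * Q + size v - 2 + Q by lia.
  case: e_cond => [e_gt1|v1].
    have: 2 * (t * Q) < (e + 2) * Q -> t < e; last by nia.
    by rewrite mulnA ltn_mul2r; lia.
  by rewrite v1; nia.
set B := wpow _ t.
have szB : size B = t * Q by rewrite size_wpow size_rot.
(* The rotation is a suffix of [w'], in which the first run of period [Q] is the
   prefix [u^e P]. *)
pose w' := w ++ take N w.
have rotE : rot N w = drop N w'.
  rewrite /w' drop_cat; case: ltnP => //; lia.
have e_gt0 : 0 < e by lia.
have [C takeE] : exists C, take N w = u ++ C.
  exists (drop Q (take N w)); rewrite -[LHS](cat_take_drop Q).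
  congr (_ ++ _); rewrite take_takel // /w -(prednK e_gt0) wpowS -catA.
  by rewrite take_size_cat.
have w'E : w' = (wpow u e ++ P) ++ [:: ~~ x; x] ++ C.
  by rewrite /w' takeE /w -!catA [v ++ _]catA vu -!catA.
have run : prefix (wpow u e ++ P) (wpow u e.+2).
  rewrite -addn2 wpowD prefix_cat2l.
  rewrite (_ : wpow u 2 = u ++ u); last by rewrite !wpowS cats0.
  by apply: (prefix_trans _ (standard_pair_run std)); apply: prefix_prefix.
have BE i : i + t * Q <= e.+2 * Q -> i %% Q = N %% Q ->
    B = take (t * Q) (drop i (wpow u e.+2)).
  by move=> le iN; rewrite take_drop_wpow // -/Q iN.
have [k eE] : exists k, e = t + k.+1 by exists (e - t).-1; lia.
have szw' : size w = t * Q + (k * Q + size P + 2).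
  rewrite szw eE mulnDl mulSn; lia.
have Fcase : exists2 F, unbordered F & infix F (rot N w) /\ size w <= t * Q + size F.
  case: t_or => [Nt|nt].
  (* This factor ends at the letter breaking the run that begins [w']. *)
  - exists (x :: wpow u k ++ P ++ [:: ~~ x]); first exact: (standard_christoffel x k std).2.
    split; last by rewrite szw' /= !size_cat size_wpow /= -/Q; lia.
    rewrite rotE w'E.
    have -> : (wpow u e ++ P) ++ [:: ~~ x; x] ++ C =
      (wpow u t ++ u0) ++ (x :: wpow u k ++ P ++ [:: ~~ x]) ++ x :: C.
      by rewrite eE wpowD wpowS [X in X ++ wpow u k]uE -!catA !cat_cons -!catA.
    rewrite drop_cat.
    have sz0 : size (wpow u t ++ u0) = t.+1 * Q - 1.
      by rewrite size_cat size_wpow mulSn /Q uE size_cat /=; lia.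
    case: ltnP => ge; first by apply/infixP; eexists; eexists.
    have -> : N - size (wpow u t ++ u0) = 0 by lia.
    by rewrite drop0; apply/infixP; exists [::]; eexists.
  (* This factor starts with the last letter of [w], just before the next run. *)
  - exists (~~ x :: wpow u k ++ P ++ [:: x]).
      by have := (standard_christoffel (~~ x) k std).2; rewrite negbK.
    split; last by rewrite szw' /= !size_cat size_wpow /= -/Q; lia.
    have pre : prefix (wpow u k ++ P ++ [:: x]) (take N w).
      rewrite prefixE take_takel; last by rewrite !size_cat size_wpow -/Q /=; lia.
      rewrite -prefixE /w (_ : e = k + t.+1); last by lia.
      rewrite wpowD -catA prefix_cat2l.
      apply: (prefix_trans (standard_pair_run std)).
      by rewrite wpowS -(prednK t_gt0) wpowS -!catA [X in prefix _ X]catA prefix_prefix.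
    case/prefixP: pre => Z tE.
    have [w0 wE] : exists w0, w = w0 ++ [:: ~~ x].
      by exists (wpow u e ++ v0); rewrite /w vE catA.
    rewrite /rot tE wE drop_cat.
    have sz0 : size w = (size w0).+1 by rewrite wE size_cat addn1.
    case: ltnP => ge.
      by apply/infixP; exists (drop N w0), Z; rewrite -[(_ ++ [:: _]) ++ _]catA.
    have -> : N - size w0 = 0 by lia.
    by apply/infixP; exists [::], Z.
case: Fcase => F ubF [Fw szF].
apply: (longest_border_unbordered_infix _ _ _ _ ubF) => //; rewrite ?szB //.
- by apply: word_neq_nil; rewrite szB muln_gt0 t_gt0.
- by rewrite size_rot; lia.
(* As a prefix, the border is read in the run at position [N]. *)
- have szX : N + t * Q <= size (wpow u e ++ P) by rewrite size_cat size_wpow -/Q; lia.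
  rewrite rotE (BE N) //; last by rewrite !mulSn; lia.
  rewrite -(take_drop_prefix run szX).
  rewrite (take_drop_prefix (Y := w') _ szX); first exact: prefix_take.
  by rewrite w'E prefix_prefix.
(* As a suffix, it is read at position [N - t Q] of [w], before the last letter
   of [w]. *)
- have X1 : prefix (wpow u e.-1 ++ P ++ [:: x]) w.
    rewrite /w -{2}(prednK e_gt0) wpowSr -catA prefix_cat2l uv.
    by rewrite prefix_cat2l -[[:: x; _]]cat1s prefix_prefix.
  have X2 : prefix (wpow u e.-1 ++ P ++ [:: x]) (wpow u e.+2).
    have -> : e.+2 = e.-1 + 3 by lia.
    rewrite wpowD prefix_cat2l; apply: (prefix_trans (standard_pair_run std)).
    by rewrite !wpowS catA prefix_prefix.
  have szX : N - t * Q + t * Q <= size (wpow u e.-1 ++ P ++ [:: x]).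
    rewrite subnK // !size_cat size_wpow -/Q /=.
    have : e * Q = e.-1 * Q + Q by rewrite -{1}(prednK e_gt0) mulSn addnC.
    lia.
  rewrite (BE (N - t * Q)).
  + rewrite -(take_drop_prefix X2 szX) (take_drop_prefix X1 szX).
    rewrite take_drop subnKC // /rot.
    by apply: suffix_catr; exact: suffix_drop.
  + by rewrite subnK // !mulSn; lia.
  + by rewrite -[in RHS](subnKC tN) modnMDl.
- by rewrite size_rot.
Qed.

Lemma rot_size_pred {u v P x} e : standard_pair u v P x ->
  rot (size u - 1) (wpow u e.+1 ++ v) = x :: wpow u e ++ P ++ [:: ~~ x].
Proof.
move=> std; have [u0 [v0 [uE _ vu0 _ _]]] := standard_pair_ends std.
have -> : size u - 1 = size u0 by rewrite uE size_cat addnK.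
by rewrite wpowS -catA [X in rot _ (X ++ _)]uE -catA rot_size_cat -!catA vu0.
Qed.

Lemma rot_size_pow_pred {u v P x} e : standard_pair u v P x ->
  rot (size (wpow u e.+1 ++ v) - 1) (wpow u e.+1 ++ v) =
  ~~ x :: wpow u e ++ P ++ [:: x].
Proof.
move=> std; have [u0 [v0 [_ vE _ uv0 _]]] := standard_pair_ends std.
have -> : wpow u e.+1 ++ v = (wpow u e ++ P ++ [:: x]) ++ [:: ~~ x].
  by rewrite wpowSr vE -uv0 -!catA.
by rewrite size_cat addnK rot_size_cat.
Qed.

Lemma rot_christoffel {u v P x} e N : standard_pair u v P x -> 0 < e ->
  N = size u - 1 \/ N = size (wpow u e ++ v) - 1 ->
  christoffel (rot N (wpow u e ++ v)) /\ unbordered (rot N (wpow u e ++ v)).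
Proof.
case: e => // e std _ [->|->].
  by rewrite (rot_size_pred e std); exact: (standard_christoffel x e std).
rewrite (rot_size_pow_pred e std); have := standard_christoffel (~~ x) e std.
by rewrite negbK.
Qed.

Lemma letter_christoffel z : christoffel [:: z] /\ unbordered [:: z].
Proof.
have root := tree_root z.
by split; [apply: (tree_christoffel _ _ _ root).1 | apply: (tree_unbordered _ _ _ root).1].
Qed.

(** * The words M as standard pairs *)

Definition Mprev (s : seq nat) (i : nat) : word :=
  if i is i'.+1 then M s i' else [:: lb].

Lemma M_S s i : M s i.+1 = wpow (M s i) (bterm s i.+1) ++ Mprev s i.
Proof. by []. Qed.

Lemma bterm_gt0 s i : (forall x, x \in s -> 0 < x) -> 0 < i < size s ->
  0 < bterm s i.+1.
Proof. by case: i => // i pos /= lt; apply: pos; rewrite mem_nth. Qed.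

Lemma M1_eq s : bterm s 1 = 0 -> M s 1 = [:: lb].
Proof. by move=> e0; rewrite M_S e0. Qed.

Lemma standard_pair_M s i : (forall x, x \in s -> 0 < x) -> i <= size s ->
  exists P x, standard_pair (M s i) (Mprev s i) P x.
Proof.
move=> pos; elim: i => [_|i IH lt].
  by exists [::], la; exact: (standard_pair_root la).
have [P [x std]] := IH (ltnW lt).
(* The exponent vanishes only for [a_1 = 1], and then the pair [(a, b)] is
   replaced by [(b, a)], which is again a root. *)
have [e0|e_gt0] := posnP (bterm s i.+1); last first.
  by do 2 eexists; rewrite M_S; exact: (standard_pair_step _ e_gt0 std).
case: i lt {IH std} e0 => [_ e0|i lt].
  by exists [::], lb; rewrite M1_eq //; exact: (standard_pair_root lb).
by have := bterm_gt0 s i.+1 pos; rewrite lt => /(_ isT); case: bterm.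
Qed.

Lemma size_M s i : (forall x, x \in s -> 0 < x) -> i <= size s ->
  size (M s i) = q s i.
Proof.
move=> pos; elim/ltn_ind: i => -[//|i] IH lt.
rewrite M_S size_cat size_wpow IH //; last exact: ltnW.
case: i IH lt => [_ lt|i IH lt] /=.
  have : 0 < term s 1 by apply: pos; rewrite mem_nth.
  by rewrite /bterm eqxx; lia.
by rewrite IH // ltnW // ltnW.
Qed.

Lemma q_gt0 s i : (forall x, x \in s -> 0 < x) -> i <= size s -> 0 < q s i.
Proof.
move=> pos le; rewrite -size_M //; have [P [x std]] := standard_pair_M s i pos le.
by have [u0 [_ [-> _ _ _ _]]] := standard_pair_ends std; rewrite size_cat addn1.
Qed.

Lemma eq_M s s' i : (forall j, j < i -> nth 0 s j = nth 0 s' j) -> M s i = M s' i.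
Proof.
elim/ltn_ind: i => -[//|i] IH eqs.
have eqM j : j < i.+1 -> M s j = M s' j.
  by move=> lt; apply: IH => // k kj; apply: eqs; exact: ltn_trans lt.
rewrite !M_S eqM //; congr (wpow _ _ ++ _).
  by rewrite /bterm /term !eqs.
by case: i eqM {IH eqs} => //= i eqM; apply: eqM.
Qed.

Lemma M_take s k : M (take k s) k = M s k.
Proof. by apply: eq_M => j lt; rewrite nth_take. Qed.

Lemma conjugator_pow_rot N w : 0 < size w ->
  conjugator_pow (Posz N) w = rot (N %% size w) w.
Proof.
move=> w_gt0 /=; elim: N => [|N IH]; first by rewrite mod0n rot0.
rewrite iterS IH conjugatorE.
have lt : N %% size w < size w by rewrite ltn_mod.
rewrite -rotS // -[in RHS]addn1 -modnDml addn1.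
case: (ltnP (N %% size w).+1 (size w)) => ge; first by rewrite (modn_small ge).
have -> : (N %% size w).+1 = size w by apply/eqP; rewrite eqn_leq lt.
by rewrite modnn rot0 rot_size.
Qed.

Lemma rotr1_M_unbordered s i : (forall x, x \in s -> 0 < x) -> i <= size s ->
  unbordered (rotr 1 (M s i)).
Proof.
move=> pos; case: i => [_|i lt]; first exact: (letter_christoffel la).2.
have [e0|e_gt0] := posnP (bterm s i.+1).
  case: i lt e0 => [_ e0|i lt e0].
    by rewrite M1_eq //; exact: (letter_christoffel lb).2.
  by have := bterm_gt0 s i.+1 pos; rewrite lt e0 => /(_ isT).
have [P [x std]] := standard_pair_M s i pos (ltnW lt).
by have [_] := rot_christoffel (bterm s i.+1) _ std e_gt0 (or_intror erefl).
Qed.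

Lemma rot_cat_shift k (X Y : word) : k <= size Y ->
  rot (size X + k) (X ++ Y) = rot k (Y ++ X).
Proof.
by move=> le; rewrite addnC rotD ?rot_size_cat // size_cat addnC leq_add2l.
Qed.

Lemma H_take s m : (forall x, x \in s -> 0 < x) -> size s = m.+1 ->
  forall k N, k <= m.+1 -> H (Posz N) (take k s) = rot (N %% q s k) (M s k).
Proof.
move=> pos szs k N le; rewrite /H size_takel ?szs // M_take -size_M ?szs //.
by apply: conjugator_pow_rot; rewrite size_M ?q_gt0 ?szs.
Qed.

Lemma H_full s m : (forall x, x \in s -> 0 < x) -> size s = m.+1 ->
  forall N, N < q s m.+1 -> H (Posz N) s = rot N (M s m.+1).
Proof.
move=> pos szs N lt; rewrite -{1}(take_oversize (eq_leq szs)).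
by rewrite (H_take s m) // modn_small.
Qed.

(** * Borders of the words H *)

Section Corollary.
Variables (s : seq nat) (m : nat).
Hypotheses (pos : forall x, x \in s -> 0 < x) (szs : size s = m.+1).

Let std i : i <= m.+1 -> exists P x, standard_pair (M s i) (Mprev s i) P x.
Proof. by rewrite -szs; exact: standard_pair_M. Qed.

Let szM i : i <= m.+1 -> size (M s i) = q s i.
Proof. by rewrite -szs; exact: size_M. Qed.

Let qpos i : i <= m.+1 -> 0 < q s i.
Proof. by rewrite -szs; exact: q_gt0. Qed.

Let bpos i : 0 < i <= m -> 0 < bterm s i.+1.
Proof. by move=> lt; apply: bterm_gt0 => //; rewrite szs ltnS. Qed.

Let Htake := H_take s m pos szs.
Let HE := H_full s m pos szs.

Let q_le : q s m <= q s m.+1.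
Proof.
have : 0 < term s m.+1 by apply: pos; rewrite mem_nth // szs.
by rewrite /=; nia.
Qed.

Let b_ge2 : 2 <= term s m.+1 -> 1 < bterm s m.+1 \/ size (Mprev s m) = 1.
Proof. by case: (m) => [|m'] ge; [right | left]. Qed.

Lemma H_christoffel N : N = q s m - 1 \/ N = q s m.+1 - 1 ->
  christoffel (H (Posz N) s) /\ unbordered (H (Posz N) s).
Proof.
move=> NE; have q_m := qpos m (leqnSn m).
have [P [x stdm]] := std m (leqnSn m).
rewrite HE; last by lia.
have [e0|e_gt0] := posnP (bterm s m.+1); last first.
  by rewrite M_S; apply: (rot_christoffel _ _ stdm e_gt0); rewrite -M_S !szM.
have m0 : m = 0 by case: m bpos e0 => // m' /(_ m'.+1); rewrite leqnn => /(_ isT); case: bterm.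
have ME : M s m.+1 = [:: lb] by move: e0; rewrite m0; exact: M1_eq.
have N0 : N = 0.
  by move: NE; rewrite -(szM m.+1) // ME m0; case.
by rewrite N0 rot0 ME; exact: letter_christoffel.
Qed.

Lemma H_longest_border_ge2_low N : 2 <= term s m.+1 -> N < q s m - 1 ->
  longest_border (H (Posz N) (rcons (take m s) (term s m.+1 - 1))) (H (Posz N) s).
Proof.
move=> ge lt; have [P [x stdm]] := std m (leqnSn m).
have szu := szM m (leqnSn m).
have e_gt1 : 1 < bterm s m.+1 by case: m lt ge => [|m'] //=; rewrite subnn.
have m_gt0 : 0 < m by case: m lt => //=; rewrite subnn.
set s' := rcons _ _.
have szs' : size s' = m.+1 by rewrite size_rcons size_takel // szs.
have nths' j : j < m -> nth 0 s' j = nth 0 s j.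
  by move=> jm; rewrite nth_rcons size_takel ?szs // jm nth_take.
have Ms' : M s' m.+1 = wpow (M s m) (bterm s m.+1).-1 ++ Mprev s m.
  rewrite M_S; congr (wpow _ _ ++ _).
  - exact: eq_M.
  - rewrite /bterm; case: eqP => [[m0]|_]; first by rewrite m0 in m_gt0.
    by rewrite /term nth_rcons size_takel ?szs // ltnn eqxx subn1.
  - by case: m m_gt0 nths' => // m' _ nths'; apply: eq_M => j jm; apply: nths'; exact: ltnW.
have szw' : N < size (M s' m.+1).
  rewrite Ms' size_cat size_wpow szu.
  have : 0 < (bterm s m.+1).-1 by lia.
  by nia.
rewrite {1}/H szs' conjugator_pow_rot; last exact: leq_ltn_trans szw'.
rewrite modn_small // Ms' HE; last by lia.
rewrite M_S; apply: (longest_border_short_rot _ _ stdm) => //.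
  by apply: rotr1_M_unbordered; rewrite // szs.
by rewrite szu; lia.
Qed.

Lemma H_longest_border_ge2_high N : 2 <= term s m.+1 -> q s m <= N < q s m.+1 - 1 ->
  longest_border
    (wpow (H (Posz N) (take m s))
       (minn (N %/ q s m) (1 + (q s m.+1 - 2 - N) %/ q s m)))
    (H (Posz N) s).
Proof.
move=> ge /andP[Nge Nlt]; have [P [x stdm]] := std m (leqnSn m).
rewrite Htake // HE; last by lia.
have := longest_border_long_rot (bterm s m.+1) N stdm (b_ge2 ge).
by rewrite -M_S !szM //; apply=> //; lia.
Qed.

End Corollary.

(** For a last term equal to 1, the word [M s m ++ M s m.+1] has the form
    [u^(e+1) v] for the standard pair [(u, v)] at index [m], and [H] is a
    rotation of it ([M_pen], [rot_cat_shift]). *)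
Section CorollaryLastOne.
Variables (s : seq nat) (m : nat).
Hypotheses (pos : forall x, x \in s -> 0 < x) (szs : size s = m.+2).
Hypothesis last1 : term s m.+2 = 1.

Let M_last : M s m.+2 = M s m.+1 ++ M s m.
Proof. by rewrite M_S /bterm /= last1 wpowS cats0. Qed.

Let M_pen : M s m ++ M s m.+1 = wpow (M s m) (bterm s m.+1).+1 ++ Mprev s m.
Proof. by rewrite M_S wpowS catA. Qed.

Let std : exists P x, standard_pair (M s m) (Mprev s m) P x.
Proof. by apply: standard_pair_M => //; rewrite szs; lia. Qed.

Let szM i : i <= m.+2 -> size (M s i) = q s i.
Proof. by rewrite -szs; exact: size_M. Qed.

Let qE : q s m.+2 = q s m.+1 + q s m.
Proof. by rewrite -!szM // ?M_last ?size_cat //; lia. Qed.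

Lemma H_longest_border_eq1_low N : N < q s m.+1 - 1 ->
  longest_border
    (wpow (H (Posz N) (take m s))
       (1 + minn (N %/ q s m) ((q s m.+1 - 2 - N) %/ q s m)))
    (H (Posz N) s).
Proof.
move=> lt; have [P [x stdm]] := std.
have q_m : 0 < q s m by apply: q_gt0; rewrite // szs; lia.
rewrite (H_take s m.+1) ?(leqW (leqnSn m)) // (H_full s m.+1) //; last by lia.
have -> : rot N (M s m.+2) = rot (N + q s m) (wpow (M s m) (bterm s m.+1).+1 ++ Mprev s m).
  by rewrite M_last -M_pen addnC -szM; [rewrite -rot_cat_shift // szM; lia | lia].
have cond : 1 < (bterm s m.+1).+1 \/ size (Mprev s m) = 1.
  case: (posnP m) => [->|m_gt0]; [by right|left].
  by rewrite ltnS; apply: bterm_gt0 => //; rewrite szs m_gt0; lia.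
have := longest_border_long_rot (bterm s m.+1).+1 (N + q s m) stdm cond.
rewrite -M_pen size_cat !szM ?leqnSn //; last by lia.
rewrite modnDr divnDr ?dvdnn // divnn q_m.
have -> : q s m + q s m.+1 - 2 - (N + q s m) = q s m.+1 - 2 - N by lia.
by rewrite [_ + 1]addnC -addn_minr; apply; lia.
Qed.

Lemma H_longest_border_eq1_high N : q s m.+1 <= N < q s m.+2 - 1 ->
  longest_border (H (Posz N) (take m.+1 s)) (H (Posz N) s).
Proof.
move=> /andP[ge lt]; have [P [x stdm]] := std.
have q_m1 : q s m <= q s m.+1.
  have : 0 < term s m.+1 by apply: pos; rewrite mem_nth // szs.
  by rewrite /=; nia.
have m_gt0 : 0 < m.
  by case: (posnP m) => // m0; move: lt ge; rewrite qE m0 /=; lia.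
have e_gt0 : 0 < bterm s m.+1.
  by apply: bterm_gt0 => //; rewrite szs m_gt0; lia.
rewrite (H_take s m.+1) ?(leqW (leqnSn m)) // (H_full s m.+1) //; last by lia.
have -> : N %% q s m.+1 = N - q s m.+1.
  by rewrite -{1}(subnK ge) modnDr modn_small //; lia.
have -> : rot N (M s m.+2) = rot (N - q s m.+1) (M s m ++ M s m.+1).
  by rewrite M_last -{1}(subnK ge) -szM // addnC rot_cat_shift // !szM; lia.
rewrite M_pen [X in longest_border (rot _ X)]M_S.
apply: (longest_border_short_rot (bterm s m.+1).+1 _ stdm) => //.
  by apply: rotr1_M_unbordered; rewrite // szs; lia.
by rewrite szM; lia.
Qed.

End CorollaryLastOne.

(* Every subtraction and division below is exact (no truncation, no zero
   divisor) under the hypotheses of its clause; in particular the first clause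
   of (b) is vacuous when m = 1. *)
Theorem corollary8p3 (m : nat) (a : m.-tuple nat) (N : nat)
    (m_ge1 : 1 <= m) (a_pos : forall x, x \in a -> 0 < x) :
  ((N = q a (m - 1) - 1 \/ N = q a m - 1) ->
     christoffel (H (Posz N) a) /\ unbordered (H (Posz N) a))
  /\
  (0 <= N <= q a m - 1 -> N <> q a (m - 1) - 1 -> N <> q a m - 1 ->
     (* (a) *)
     (2 <= term a m ->
        (0 <= N < q a (m - 1) - 1 ->
           longest_border
             (H (Posz N) (rcons (take (m - 1) a) (term a m - 1)))
             (H (Posz N) a))
        /\
        (q a (m - 1) <= N < q a m - 1 ->
           longest_border
             (wpow (H (Posz N) (take (m - 1) a))
                (minn (N %/ q a (m - 1))
                      (1 + (q a m - 2 - N) %/ q a (m - 1))))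
             (H (Posz N) a)))
     /\
     (* (b) *)
     (term a m = 1 ->
        (0 <= N < q a (m - 1) - 1 ->
           longest_border
             (wpow (H (Posz N) (take (m - 2) a))
                (1 + minn (N %/ q a (m - 2))
                          ((q a (m - 1) - 2 - N) %/ q a (m - 2))))
             (H (Posz N) a))
        /\
        (q a (m - 1) <= N < q a m - 1 ->
           longest_border (H (Posz N) (take (m - 1) a)) (H (Posz N) a)))).
Proof.
case: m a m_ge1 a_pos => // m' a _ a_pos.
have sza : size a = m'.+1 by rewrite size_tuple.
rewrite !subSS subn0; split; first exact: H_christoffel.
move=> _ _ _; split=> [ge|last1].
  split=> [/andP[_ lt]|lt]; first exact: H_longest_border_ge2_low.
  exact: H_longest_border_ge2_high.
case: m' a a_pos sza last1 => [|m'] a a_pos sza last1.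
  by rewrite /= last1; split; lia.
rewrite subSS subn0.
split=> [/andP[_ lt]|lt]; first exact: H_longest_border_eq1_low.
exact: H_longest_border_eq1_high.
Qed.
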